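(* A finite hypergraph is realizable by a family of axis-parallel rectangles whose $y$-projections form a nested family if and only if it is realizable by finite arithmetic progressions whose difference is a power of $2$ (i.e. lies in $\{2^i: i\in\mathbb{N}\}$).
   Context: A hypergraph $H=(V,E)$ has a finite vertex set $V$ and an edge set $E$ consisting of subsets of $V$. An axis-parallel rectangle is a set $\{(x,y): x_1\le x\le x_2,\ y_1\le y\le y_2\}$; its $y$-projection is $[y_1,y_2]$. A family of intervals (repetitions allowed) is nested if any two members $A,B$ satisfy $A\subseteq B$, $B\subseteq A$ or $A\cap B=\emptyset$. For $P\subset\mathbb{R}^2$ and a family $\mathcal{F}$ of planar sets, $H(P,\mathcal{F})$ is the hypergraph with vertex set $P$ and edge set $\{P\cap F: F\in\mathcal{F}\}$. $H$ is realizable by a family of rectangles with nested $y$-projections if there exist a finite $P\subset\mathbb{R}^2$, such a family $\mathcal{R}$, and a bijection $\varphi:V\to P$ mapping $E$ onto the edge set of $H(P,\mathcal{R})$. A finite arithmetic progression with difference $d\in\mathbb{N}$, $d\ge1$, is a set $\{a,a+d,\dots,a+(\ell-1)d\}$ with $a\in\mathbb{Z}$, $\ell\ge1$. For $D\subseteq\mathbb{N}$, $H$ is realizable by arithmetic progressions whose difference is in $D$ if there exist $W\subset\mathbb{Z}$, a family $\mathcal{A}$ of finite arithmetic progressions with differences in $D$, and a bijection $\varphi:V\to W$ mapping $E$ onto $\{A\cap W: A\in\mathcal{A}\}$. *)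

(* Defs.v *)
From mathcomp Require Import all_boot all_order all_algebra.
From mathcomp Require Import boolp classical_sets functions cardinality reals.

Set Implicit Arguments.
Unset Strict Implicit.
Unset Printing Implicit Defensive.

Local Open Scope classical_set_scope.
Local Open Scope ring_scope.

Record hypergraph := Hypergraph {
  vertex : finType;
  edges : {set {set vertex}} }.

(* The edge set of H(P, F). *)
Definition traces (T : Type) (P : set T) (F : set (set T)) : set (set T) :=
  [set P `&` A | A in F].

(* [phi] is a bijection from the vertices of [H] onto [P] which, acting on
   vertex sets by direct image, maps the edges of [H] onto those of H(P, F). *)
Definition realizes (H : hypergraph) (T : Type) (P : set T) (F : set (set T))
    (phi : vertex H -> T) : Prop :=
  set_bij [set: vertex H] P phi /\
  [set phi @` [set` e] | e in [set` edges H]] = traces P F.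

Definition rectangle (R : realType) (x1 x2 y1 y2 : R) : set (R * R) :=
  [set p : R * R | x1 <= p.1 <= x2 /\ y1 <= p.2 <= y2].

(* Rectangles are nonempty but may degenerate to segments or points. *)
Definition is_rectangle (R : realType) (A : set (R * R)) : Prop :=
  exists x1 x2 y1 y2 : R,
    [/\ x1 <= x2, y1 <= y2 & A = rectangle x1 x2 y1 y2].

(* For A = rectangle x1 x2 y1 y2 nonempty, this is the interval [y1, y2]. *)
Definition y_projection (R : realType) (A : set (R * R)) : set R :=
  snd @` A.

(* The family (f i), i in J; distinct indices may carry the same set. *)
Definition nested (I T : Type) (J : set I) (f : I -> set T) : Prop :=
  forall i j, J i -> J j ->
    [\/ f i `<=` f j, f j `<=` f i | f i `&` f j = set0].

Definition realizable_by_nested_rectangles (R : realType) (H : hypergraph)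
    : Prop :=
  exists (P : set (R * R)) (F : set (set (R * R))) (phi : vertex H -> R * R),
    [/\ finite_set P,
        forall A, F A -> is_rectangle A,
        nested F (@y_projection R) &
        realizes P F phi].

(* {a, a + d, ..., a + (l - 1) d} *)
Definition arith_prog (a : int) (d l : nat) : set int :=
  [set a + (k * d)%N%:Z | k in [set k : nat | (k < l)%N]].

Definition is_arith_prog_with (D : set nat) (A : set int) : Prop :=
  exists (a : int) (d l : nat),
    [/\ D d, (1 <= d)%N, (1 <= l)%N & A = arith_prog a d l].

Definition realizable_by_arith_progs (D : set nat) (H : hypergraph) : Prop :=
  exists (W : set int) (F : set (set int)) (phi : vertex H -> int),
    (forall A, F A -> is_arith_prog_with D A) /\ realizes W F phi.

Definition powers_of_two : set nat := [set (2 ^ i)%N | i in [set: nat]].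

(* Main.v *)
(** Only congruence classes modulo powers of two and intervals matter on the
    arithmetic side, only nested intervals in y and intervals in x on the
    rectangle side.

    From rectangles to progressions: the y-projections cut out a laminar family
    of vertex sets.  List it by decreasing cardinality as S_0, S_1, ..., and put
    f(v) = sum of the 2^j with v in S_j.  Elements of S_j agree on all earlier
    sets, so S_j is a class of f modulo 2^(j+1).  Then choose integers that are
    congruent to f modulo a large power of two and ordered compatibly with x.

    From progressions to rectangles: place the integer w at height the reversal
    of its N lowest bits.  A class modulo 2^i becomes a dyadic interval, and
    dyadic intervals are nested. *)
Require Import Defs.
From mathcomp Require Import all_boot all_order all_algebra.
From mathcomp Require Import boolp classical_sets functions cardinality reals.
From mathcomp Require Import zify.

Set Implicit Arguments.
Unset Strict Implicit.
Unset Printing Implicit Defensive.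

Import Order.TTheory GRing.Theory Num.Theory.

Local Open Scope classical_set_scope.
Local Open Scope ring_scope.

(** * Realizability checked one edge at a time *)

Lemma realizes_preimage (H : hypergraph) (T : Type) (P : set T)
    (F : set (set T)) (phi : vertex H -> T) :
  realizes P F phi ->
  injective phi /\
  forall e, e \in edges H ->
    exists2 A, F A & forall v, v \in e <-> A (phi v).
Proof.
move=> [[phiP phi_inj _] eqE].
have inj : injective phi by move=> u v; apply: phi_inj; rewrite in_setT.
split=> // e He.
have : traces P F (phi @` [set` e]) by rewrite -eqE; exists e.
case=> A FA eqA; exists A => // v; split=> [ve|Av].
  have : (phi @` [set` e]) (phi v) by exists v.
  by rewrite -eqA => -[].
have : (P `&` A) (phi v) by split=> //; apply: phiP.
by rewrite eqA => -[w we /inj <-].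
Qed.

(** The traces must be exactly the edges, so [F] is cut down to the members that trace an edge. *)
Lemma realizes_range (H : hypergraph) (T : Type) (F : set (set T))
    (phi : vertex H -> T) :
  injective phi ->
  (forall e, e \in edges H -> exists2 A, F A & forall v, v \in e <-> A (phi v)) ->
  realizes (range phi)
    [set A | F A /\ exists2 e, e \in edges H & forall v, v \in e <-> A (phi v)]
    phi.
Proof.
move=> inj edgeF.
have imE (e : {set vertex H}) (A : set T) : (forall v, v \in e <-> A (phi v)) ->
    range phi `&` A = phi @` [set` e].
  move=> eA; apply/seteqP; split=> t.
    by case=> -[v _ <-] Av; exists v => //; apply/eA.
  by case=> v ve <-; split; [exists v | apply/eA].
split.
  split=> [v _|u v _ _ /inj //|t [v _ <-]]; first by exists v.
  by exists v.
apply/seteqP; split=> B.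
  case=> e He <-; have [A FA eA] := edgeF e He.
  by exists A; [split=> //; exists e | exact: imE].
by case=> A [_ [e He eA]] <-; exists e => //; rewrite (imE e A eA).
Qed.

(** * Laminar families as residue classes modulo powers of two *)

Lemma modn_bit (b : bool) (m i : nat) :
  ((b + 2 * m) %% 2 ^ i.+1 = b + 2 * (m %% 2 ^ i))%N.
Proof.
have lt_m : (m %% 2 ^ i < 2 ^ i)%N by rewrite ltn_pmod ?expn_gt0.
by rewrite expnS -modnDmr -muln_modr modn_small //; case: b; lia.
Qed.

Fixpoint membership_code (V : finType) (s : seq {set V}) (v : V) : nat :=
  if s is A :: s' then ((v \in A) + 2 * membership_code s' v)%N else 0%N.

(** The exponent is one more than the position of [B]. Each earlier set contains [B] or misses it,
    so its bit is constant on [B]; the last bit compared is membership in [B] itself. *)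
Lemma membership_code_mod (V : finType) (s : seq {set V}) (B : {set V}) :
  pairwise (fun A C : {set V} => (C \subset A) || [disjoint C & A]) s ->
  B \in s ->
  exists2 i, (i <= size s)%N & forall v w, w \in B ->
    (v \in B) = (membership_code s v == membership_code s w %[mod 2 ^ i]).
Proof.
have modS (b c : bool) m n i : (b + 2 * m == c + 2 * n %[mod 2 ^ i.+1])%N =
    (b == c) && (m == n %[mod 2 ^ i])%N.
  by rewrite !modn_bit; case: b; case: c; lia.
elim: s => // A s IHs /= /andP[/allP nestA /IHs{}IHs].
rewrite inE; have [-> _|_ /= Bs] := eqVneq B A.
  exists 1%N => // v w wA.
  by rewrite (modS _ _ _ _ 0%N) !modn1 eqxx andbT wA eqb_id.
have [i les cls] := IHs Bs; exists i.+1 => // v w wB.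
rewrite modS -(cls v w wB); case: (boolP (v \in B)) => vB; last by rewrite andbF.
rewrite andbT; have /orP[/fintype.subsetP BA|dBA] := nestA _ Bs.
  by rewrite !BA.
by rewrite !(disjointFr dBA).
Qed.

Lemma laminar_mod_code (V : finType) (Q : set {set V}) :
  (forall A B : {set V}, Q A -> Q B ->
     [|| A \subset B, B \subset A | [disjoint A & B]]) ->
  exists (f : V -> nat) (N : nat), forall B, Q B ->
    exists2 i, (i <= N)%N & forall v w, w \in B ->
      (v \in B) = (f v == f w %[mod 2 ^ i])%N.
Proof.
move=> lam.
pose geq_card (A B : {set V}) := (#|B| <= #|A|)%N.
pose s := sort geq_card [seq A <- enum {: {set V}} | `[<Q A>]].
have sQ A : A \in s <-> Q A.
  rewrite mem_sort mem_filter mem_enum andbT; split; first by move/asboolP.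
  by move=> ?; apply/asboolP.
exists (membership_code s), (size s) => B QB.
apply: membership_code_mod; last exact/sQ.
have : pairwise geq_card s.
  rewrite -sorted_pairwise => [|A C D]; last by rewrite /geq_card; lia.
  by apply: sort_sorted => A C; rewrite /geq_card; lia.
apply: (sub_in_pairwise (P := mem s)); last exact/allP.
move=> A C As Cs leCA.
have /or3P[AC|->//|AC] := lam A C ((sQ _).1 As) ((sQ _).1 Cs).
  (* Here [A] lies inside the later set [C], which is no larger, so they coincide. *)
  have /eqP -> : A == C by rewrite eqEcard AC.
  by rewrite subxx.
by rewrite disjoint_sym AC orbT.
Qed.

(** Vertices with equal [x] still need distinct ranks: positions in a sorted list break ties, and
    only the implication from ranks to [x] remains. *)
Lemma compatible_rank (d : Order.disp_t) (T : orderType d) (V : finType)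
    (x : V -> T) :
  exists2 r : V -> nat, injective r &
    forall u v, (r u <= r v)%N -> (x u <= x v)%O.
Proof.
pose s := sort (fun u v => (x u <= x v)%O) (enum V).
have sV v : v \in s by rewrite mem_sort mem_enum.
exists (index^~ s) => [u v eq_uv|u v le_uv].
  by rewrite -(nth_index u (sV u)) eq_uv nth_index.
rewrite -{1}(nth_index u (sV u)) -(nth_index u (sV v)).
have le_tr : transitive (fun u v => (x u <= x v)%O).
  by move=> b a c; apply: le_trans.
have le_rf : reflexive (fun u v => (x u <= x v)%O) by move=> a; exact: le_refl.
have s_sorted : sorted (fun u v => (x u <= x v)%O) s.
  by apply: sort_sorted => a b; exact: le_total.
by apply: (sorted_leq_nth le_tr le_rf u s_sorted); rewrite ?inE ?index_mem.
Qed.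

Lemma nat_arith_progP (a b d n : nat) :
  (0 < d)%N -> (a <= b)%N ->
  (a <= n <= b)%N && (n == a %[mod d])%N <->
  arith_prog a%:Z d ((b - a) %/ d).+1 n%:Z.
Proof.
move=> d0 leab; split.
  case/andP=> /andP[lean lenb]; rewrite eqn_mod_dvd // => /dvdnP[k Ek].
  exists k => /=; last by rewrite -Ek; lia.
  by rewrite ltnS leq_divRL // -Ek leq_sub2r.
case=> k /=; rewrite ltnS leq_divRL // => lek En.
have -> : n = (a + k * d)%N by lia.
by rewrite addnC modnMDl eqxx andbT; lia.
Qed.

(** * From nested rectangles to progressions *)

Lemma arith_progs_of_nested_rectangles (R : realType) (H : hypergraph) :
  realizable_by_nested_rectangles R H ->
  realizable_by_arith_progs powers_of_two H.
Proof.
case=> P [F [phi [_ rectF nestF /realizes_preimage[_ edgeF]]]].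
pose strip A := [set v | `[<y_projection A (phi v).2>]]%SET.
have stripP A v : v \in strip A <-> y_projection A (phi v).2.
  by rewrite inE asboolE.
have [f [N fN]] : exists (f : vertex H -> nat) (N : nat),
    forall B, [set strip A | A in F] B -> exists2 i, (i <= N)%N &
      forall v w, w \in B -> (v \in B) = (f v == f w %[mod 2 ^ i])%N.
  apply: laminar_mod_code => _ _ [A FA <-] [B FB <-].
  have [AB|BA|dAB] := nestF A B FA FB; apply/or3P.
  - by apply: Or31; apply/fintype.subsetP => v /stripP Av; apply/stripP/AB.
  - by apply: Or32; apply/fintype.subsetP => v /stripP Bv; apply/stripP/BA.
  - apply: Or33; apply/pred0P => v; apply/negP => /= /andP[/stripP Av /stripP Bv].
    have : (y_projection A `&` y_projection B) (phi v).2 by [].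
    by rewrite dAB.
have [r r_inj rP] := compatible_rank (fun v => (phi v).1).
(* The rank forms the high part, which decides the order; the [N] low bits carry the residues of
   [f]. *)
pose psi v := (r v * 2 ^ N + f v %% 2 ^ N)%N.
have psi_div v : (psi v %/ 2 ^ N)%N = r v.
  by rewrite divnMDl ?expn_gt0 // divn_small ?addn0 // ltn_pmod ?expn_gt0.
have psi_mod v i : (i <= N)%N -> (psi v = f v %[mod 2 ^ i])%N.
  move=> leiN; have dv : (2 ^ i %| 2 ^ N)%N by rewrite dvdn_exp2l.
  by rewrite -modnDml -(modnMmr (r v)) (eqP dv) muln0 mod0n add0n modn_dvdm.
have psi_x u v : (psi u <= psi v)%N -> (phi u).1 <= (phi v).1.
  by move=> /(leq_div2r (2 ^ N)); rewrite !psi_div => /rP.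
exists (range (fun v => (psi v)%:Z)).
(* The family stays open until [realizes_range] supplies it. *)
eexists; exists (fun v => (psi v)%:Z); split; last first.
  apply: (@realizes_range _ _ (is_arith_prog_with powers_of_two)).
    by move=> u v [/(congr1 (fun n => n %/ 2 ^ N)%N)]; rewrite !psi_div => /r_inj.
  move=> e He; have [A FA eA] := edgeF e He.
  have [->|[w we]] := set_0Vmem e.
    (* The empty edge: the single term -1 avoids all values of [psi], which are natural numbers. *)
    exists (arith_prog (-1) 1 1).
      by exists (-1), 1%N, 1%N; split=> //; exists 0%N.
    by move=> v; rewrite inE; split=> // -[k /=]; lia.
  have [x1 [x2 [y1 [y2 [le_x le_y defA]]]]] := rectF A FA.
  have eAE v : v \in e <-> [/\ x1 <= (phi v).1 <= x2 & v \in strip A].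
    rewrite eA; split.
      move=> Av; split; first by move: Av; rewrite defA => -[].
      by apply/stripP; exists (phi v).
    by case=> xv /stripP[p]; rewrite defA => -[_ yp] eqp; split=> //; rewrite -eqp.
  have [i leiN stripE] := fN (strip A) (ex_intro2 _ _ A FA erefl).
  have [_ wS] := (eAE w).1 we.
  (* The bounds [x1] and [x2] have no integer counterpart; the extreme vertices of the edge replace
     them. *)
  pose lo := [arg min_(v < w in e) psi v].
  pose hi := [arg max_(v > w in e) psi v].
  have [loe lo_min] : lo \in e /\ forall v, v \in e -> (psi lo <= psi v)%N.
    by rewrite /lo; case: arg_minnP.
  have [hie hi_max] : hi \in e /\ forall v, v \in e -> (psi v <= psi hi)%N.
    by rewrite /hi; case: arg_maxnP.
  have [/andP[x1lo _] loS] := (eAE lo).1 loe.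
  have [/andP[_ hix2] _] := (eAE hi).1 hie.
  exists (arith_prog (psi lo) (2 ^ i) ((psi hi - psi lo) %/ 2 ^ i).+1).
    by exists (psi lo), (2 ^ i)%N, ((psi hi - psi lo) %/ 2 ^ i).+1; split=> //;
      [exists i | rewrite expn_gt0].
  have le_lohi := lo_min _ hie.
  move=> v; rewrite -nat_arith_progP ?expn_gt0 //.
  rewrite !psi_mod // -(stripE v lo loS); split.
    by move=> ve; rewrite lo_min ?hi_max //=; have [] := (eAE v).1 ve.
  case/andP=> /andP[lov vhi] vS; apply/eAE; split=> //.
  by rewrite (le_trans x1lo (psi_x _ _ lov)) (le_trans (psi_x _ _ vhi) hix2).
by move=> A [].
Qed.

(** * Bit reversal and dyadic intervals *)

Fixpoint bitrev (n m : nat) : nat :=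
  if n is n'.+1 then (odd m * 2 ^ n' + bitrev n' m./2)%N else 0%N.

Lemma bitrev_lt (n m : nat) : (bitrev n m < 2 ^ n)%N.
Proof.
elim: n m => //= n IHn m; have := IHn m./2; rewrite expnS; case: (odd m); lia.
Qed.

(** Reversal moves the [i] low bits to the top, and the division keeps just those. *)
Lemma bitrev_div (n i m m' : nat) : (i <= n)%N ->
  (bitrev n m %/ 2 ^ (n - i) == bitrev n m' %/ 2 ^ (n - i))%N =
  (m == m' %[mod 2 ^ i])%N.
Proof.
elim: n i m m' => [|n IHn] [|i] m m' //.
- by rewrite !modn1 !eqxx.
- by rewrite !modn1 subn0 !divn_small ?bitrev_lt.
rewrite ltnS subSS => lein.
have splitE k : (bitrev n.+1 k %/ 2 ^ (n - i) =
    odd k * 2 ^ i + bitrev n k./2 %/ 2 ^ (n - i))%N.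
  by rewrite /= -{1}(subnKC lein) expnD mulnA divnMDl ?expn_gt0.
have quo_lt k : (bitrev n k %/ 2 ^ (n - i) < 2 ^ i)%N.
  by rewrite ltn_divLR ?expn_gt0 // -expnD subnKC // bitrev_lt.
have modE k : (k %% 2 ^ i.+1 = odd k + 2 * (k./2 %% 2 ^ i))%N.
  by rewrite -{1}(odd_double_half k) -mul2n modn_bit.
rewrite !splitE !modE; have := IHn i m./2 m'./2 lein.
have := quo_lt m./2; have := quo_lt m'./2.
move: (_ %/ _)%N (_ %/ _)%N (_ %% _)%N (_ %% _)%N => q' q r r'.
by case: (odd m); case: (odd m') => /=; lia.
Qed.

(* Stopping at the last integer of the block, rather than at the start of the
   next one, keeps distinct intervals of the same level disjoint. *)
Definition dyadic (R : realType) (k c : nat) : set R :=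
  [set y : R | (c * 2 ^ k)%N%:R <= y <= (c * 2 ^ k + (2 ^ k).-1)%N%:R].

Lemma dyadic_nat (R : realType) (k c n : nat) :
  dyadic k c (n%:R : R) <-> (n %/ 2 ^ k)%N = c.
Proof.
rewrite /dyadic /= !ler_nat; have k0 := expn_gt0 2 k.
have := divn_eq n (2 ^ k); have := ltn_pmod n k0.
set q := (n %/ _)%N; set r := (n %% _)%N => ltr ->.
split=> [|<-]; last by lia.
by move: (2 ^ k)%N ltr k0 => t ltr k0 /andP[h1 h2]; nia.
Qed.

(** The coarser interval runs from block [a] to block [b] of level [k]; block [c] is one of these or
    lies strictly to one side of them all. *)
Lemma dyadic_nested (R : realType) (k c k' c' : nat) : (k <= k')%N ->
  dyadic k c `<=` (dyadic k' c' : set R) \/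
  dyadic k c `&` dyadic k' c' = set0 :> set R.
Proof.
move=> lekk'.
have -> : (dyadic k' c' : set R) = [set y | (c' * 2 ^ (k' - k) * 2 ^ k)%N%:R
   <= y <= ((c' * 2 ^ (k' - k) + (2 ^ (k' - k)).-1) * 2 ^ k + (2 ^ k).-1)%N%:R].
  have k0 := expn_gt0 2 k; have k0' := expn_gt0 2 (k' - k).
  rewrite /dyadic -(subnK lekk') expnD addnK mulnA.
  have -> // : (c' * 2 ^ (k' - k) * 2 ^ k + (2 ^ (k' - k) * 2 ^ k).-1 =
    (c' * 2 ^ (k' - k) + (2 ^ (k' - k)).-1) * 2 ^ k + (2 ^ k).-1)%N.
  by nia.
set a := (c' * _)%N; set b := (a + _)%N; have k0 := expn_gt0 2 k.
have [ltca|leac] := ltnP c a.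
  right; apply/seteqP; split=> // y [/andP[_ yc] /andP[ay _]].
  have := le_trans ay yc; rewrite ler_nat; nia.
have [ltbc|lecb] := ltnP b c.
  right; apply/seteqP; split=> // y [/andP[cy _] /andP[_ yb]].
  have := le_trans cy yb; rewrite ler_nat; nia.
left=> y /andP[cy yc]; apply/andP; split.
  by apply: le_trans cy; rewrite ler_nat leq_mul2r leac orbT.
by apply: le_trans yc _; rewrite ler_nat leq_add2r leq_mul2r lecb orbT.
Qed.

Lemma y_projection_rectangle (R : realType) (x1 x2 y1 y2 : R) : x1 <= x2 ->
  y_projection (rectangle x1 x2 y1 y2) = [set y | y1 <= y <= y2].
Proof.
move=> le_x; apply/seteqP; split=> y; first by case=> p [_ yp] <-.
by move=> yP; exists (x1, y) => //; split=> //=; rewrite lexx.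
Qed.

(** * From progressions to nested rectangles *)

Lemma nested_rectangles_of_arith_progs (R : realType) (H : hypergraph) :
  realizable_by_arith_progs powers_of_two H ->
  realizable_by_nested_rectangles R H.
Proof.
case=> W [F [phi [apF /realizes_preimage[phi_inj edgeF]]]].
(* A shift that makes all labels nonnegative, so that [absz] loses nothing. *)
pose M := (\sum_v `|phi v|)%N.
pose psi v := absz (phi v + M%:Z).
have psiE v : (psi v)%:Z = phi v + M%:Z.
  by have : (`|phi v| <= M)%N; [rewrite /M (bigD1 v) //= leq_addr | rewrite /psi; lia].
(* Any bound on [psi] serves as a bit length, since n < 2^n. *)
pose N := (\sum_v psi v)%N.
have psi_lt v : (psi v < 2 ^ N)%N.
  apply: leq_ltn_trans (ltn_expl N (isT : 1 < 2)%N).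
  by rewrite /N (bigD1 v) //= leq_addr.
pose pt v : R * R := ((phi v)%:~R, (bitrev N (psi v))%:R).
pose box (A : set (R * R)) := exists (x1 x2 : R) (k c : nat), x1 <= x2 /\
  A = rectangle x1 x2 (c * 2 ^ k)%N%:R (c * 2 ^ k + (2 ^ k).-1)%N%:R.
exists (range pt); eexists; exists pt; split; last first.
- apply: (@realizes_range _ _ box).
    by move=> u v [/eqP]; rewrite eqr_int => /eqP /phi_inj.
  move=> e He; have [A FA eA] := edgeF e He.
  have boxI (a b : int) k c : a <= b ->
      (forall v, v \in e <->
         a <= phi v <= b /\ (bitrev N (psi v) %/ 2 ^ k = c)%N) ->
      exists2 B, box B & forall v, v \in e <-> B (pt v).
    move=> leab eE; eexists; first by exists a%:~R, b%:~R, k, c; rewrite ler_int.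
    move=> v; rewrite eE /rectangle /= !ler_int; split=> -[? h]; split=> //.
      exact/dyadic_nat.
    exact/(@dyadic_nat R).
  have [e0|[u ue]] := set_0Vmem e.
    (* The empty edge: this abscissa is left of every vertex. *)
    apply: (boxI (- M%:Z - 1) (- M%:Z - 1) 0%N 0%N) => // v.
    by rewrite e0 inE; split=> // -[]; have := psiE v; lia.
  have [a [d [l [[i _ <-] _ l_gt0 defA]]]] := apF A FA.
  have [leiN|ltNi] := leqP i N; last first.
    (* All labels lie in a window shorter than [2 ^ N], so a larger difference leaves only [u] in
       the edge. Block 0 of level [N] contains every height. *)
    apply: (boxI (phi u) (phi u) N 0%N) => // v.
    rewrite (divn_small (bitrev_lt _ _)).
    split=> [ve|[uv _]]; last by have /phi_inj -> : phi v = phi u by lia.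
    split=> //; have -> : v = u; last by rewrite lexx.
    apply: phi_inj.
    move: ((eA u).1 ue) ((eA v).1 ve); rewrite defA => -[k /= _ Eu] [k' /= _ Ev].
    have lt2 : (2 ^ N < 2 ^ i)%N by rewrite ltn_exp2l.
    have := psiE u; have := psiE v; have := psi_lt u; have := psi_lt v.
    move: (2 ^ i)%N (2 ^ N)%N lt2 Eu Ev => t s lt_st Eu Ev hv hu hv' hu'.
    by have [ltk|ltk|eqk] := ltngtP k k'; [nia|nia|rewrite -Eu -Ev eqk].
  move: ((eA u).1 ue); rewrite defA => -[ku /= ltku Eu].
  (* First and last term bound the abscissa; the block of [u] encodes the residue class. *)
  apply: (boxI a (a + (l.-1 * 2 ^ i)%N%:Z) (N - i)%N
            (bitrev N (psi u) %/ 2 ^ (N - i))%N); first by rewrite lerDl.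
  move=> v; rewrite eA defA.
  have -> : (bitrev N (psi v) %/ 2 ^ (N - i) = bitrev N (psi u) %/ 2 ^ (N - i))%N
      <-> (psi v = psi u %[mod 2 ^ i])%N.
    by split=> /eqP h; apply/eqP; move: h; rewrite bitrev_div.
  have := psiE v; have := psiE u; have := expn_gt0 2 i.
  move: (2 ^ i)%N Eu => t Eu /= t_gt0 Eu' Ev'; split.
    case=> k /= ltk Ev; split; first by nia.
    (* Adding the other vertex's multiple of [t] to each side makes both numbers equal and avoids
       subtraction. *)
    rewrite -(modnMDl ku (psi v)) -(modnMDl k (psi u)).
    by congr (_ %% _)%N; lia.
  case=> /andP[ge_a le_b] eq_mod.
  have := divn_eq (psi v) t; have := divn_eq (psi u) t; rewrite eq_mod => Du Dv.
  (* The index of [phi v] in the progression, taken in the integers until [ge_a] gives its sign. *)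
  pose z := ku%:Z + (psi v %/ t)%N%:Z - (psi u %/ t)%N%:Z.
  have Dphi : phi v = a + z * t%:Z by rewrite /z; lia.
  have z_ge0 : 0 <= z by nia.
  by exists (absz z) => /=; nia.
- move=> A B [[x1 [x2 [k [c [le_x ->]]]]] _] [[x1' [x2' [k' [c' [le_x' ->]]]]] _].
  rewrite !y_projection_rectangle //; have [lek|/ltnW lek] := leqP k k'.
    by have [?|?] := @dyadic_nested R k c k' c' lek; [apply: Or31|apply: Or33].
  have [?|?] := @dyadic_nested R k' c' k c lek; first exact: Or32.
  by apply: Or33; rewrite setIC.
- move=> A [[x1 [x2 [k [c [le_x ->]]]]] _].
  by do 4!eexists; split; last reflexivity; rewrite ?ler_nat ?leq_addr.
- by apply: finite_image; exact: finite_finset.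
Qed.

Theorem theorem4 (R : realType) (H : hypergraph) :
  realizable_by_nested_rectangles R H <->
  realizable_by_arith_progs powers_of_two H.
Proof.
split; first exact: arith_progs_of_nested_rectangles.
exact: nested_rectangles_of_arith_progs.
Qed.
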